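(* Let $(\mathcal{X}, \mathcal{T}, g)$ be a compact $n$-dimensional indefinite metric polyhedron with vertex set $\mathcal{V}$. Let $d = \max\{\deg(v) \mid v \in \mathcal{V}\}$ and let $q = \max\{d, 2n+1\}$. Then there exists a simplicial isometric embedding of $\mathcal{X}$ into $\mathbb{R}^{q,q}$.
   Context: An indefinite metric polyhedron is a triple $(\mathcal{X}, \mathcal{T}, g)$ where $\mathcal{X}$ is a topological space, $\mathcal{T}$ is a locally finite simplicial triangulation of $\mathcal{X}$ with vertex set $\mathcal{V}$ and edge set $\mathcal{E}$, and $g : \mathcal{E} \to \mathbb{R}$ is an arbitrary function. It is $n$-dimensional if $n$ is the maximal dimension of a simplex of $\mathcal{T}$. When $\mathcal{X}$ is compact, $\mathcal{T}$ is finite. The degree $\deg(v)$ of a vertex $v$ is the number of edges of $\mathcal{T}$ incident with $v$. Minkowski space $\mathbb{R}^{p,q}$ is $\mathbb{R}^{p+q}$ endowed with the symmetric bilinear form $\langle \vec v, \vec w\rangle = \sum_{i=1}^{p} v_i w_i - \sum_{j=p+1}^{p+q} v_j w_j$. A simplicial map from $\mathcal{X}$ to $\mathbb{R}^N$ is a map that is affine (in barycentric coordinates) on each simplex of $\mathcal{T}$; it is determined by its values on $\mathcal{V}$. The signed square is $s(x) = x^2$ for $x \ge 0$ and $s(x) = -x^2$ for $x<0$; put $g^2(e) := s(g(e))$ for $e \in \mathcal{E}$. A simplicial isometric embedding of $(\mathcal{X}, \mathcal{T}, g)$ into $\mathbb{R}^{p,q}$ is a simplicial map $h : \mathcal{X}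 \to \mathbb{R}^{p,q}$ that is a topological embedding and satisfies $\langle h(v_i) - h(v_j), h(v_i) - h(v_j)\rangle = g^2(e_{ij})$ for every edge $e_{ij} \in \mathcal{E}$ with endpoints $v_i, v_j$. *)

(* Defs.v *)
From HB Require Import structures.
From mathcomp Require Import all_boot all_order all_algebra finmap.
From mathcomp Require Import all_classical all_reals all_analysis.

Set Implicit Arguments.
Unset Strict Implicit.
Unset Printing Implicit Defensive.

Import Order.TTheory GRing.Theory Num.Theory.
Import numFieldNormedType.Exports.

Local Open Scope classical_set_scope.
Local Open Scope ring_scope.

(* The closed geometric simplex spanned by the vertices of s, in barycentric
   coordinates. *)
Definition geom_simplex (R : realType) (V : choiceType) (s : {fset V}) :
    set {ptws V -> R} :=
  [set x | [/\ forall v, 0 <= x v,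
               forall v, v \notin s -> x v = 0 &
               \sum_(v <- s) x v = 1]].
Arguments geom_simplex R {V} s.

Definition bary_vertex (R : realType) (V : choiceType) (v : V) :
    {ptws V -> R} := fun w => (w == v)%:R.
Arguments bary_vertex R {V} v.

(* A locally finite triangulation of X with vertex set V: an abstract simplicial
   complex on V together with a homeomorphism from its geometric realization
   onto X.  Only the values of the chart on the realization matter.  The
   realization carries the usual coherent (weak) topology: a subset is closed
   iff its trace on every closed simplex is closed; this is [chart_closedP],
   where closedness in the closed set |s| is tested in the product topology of
   R^V, which induces the Euclidean topology on |s|. *)
Record triangulation (R : realType) (X : topologicalType) (V : choiceType) :=
  Triangulation {
    simplex : set {fset V};
    simplex_neq0 : forall s, simplex s -> s != fset0;
    simplex_vertex : forall v, simplex [fset v]%fset;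
    simplex_face : forall s t,
      simplex s -> (t `<=` s)%fset -> t != fset0 -> simplex t;
    locally_finite : forall v, finite_set [set s | simplex s /\ v \in s];
    chart : {ptws V -> R} -> X;
    chart_bij :
      set_bij (\bigcup_(s in simplex) geom_simplex R s) [set: X] chart;
    chart_closedP : forall A : set X,
      closed A <->
      (forall s, simplex s -> closed (geom_simplex R s `&` chart @^-1` A))
  }.

Section Polyhedra.
Context (R : realType) (X : topologicalType) (V : choiceType).
Implicit Type T : triangulation R X V.

Definition vertex_point T (v : V) : X := chart T (bary_vertex R v).

Definition edges T : set {fset V} :=
  [set e | simplex T e /\ #|` e| = 2%N].

(* [fset_set] would return the empty set on an infinite set; by local finiteness
   the set of incident edges is always finite. *)
Definition degree T (v : V) : nat :=
  #|` fset_set [set e | edges T e /\ v \in e]|.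

Definition is_max (A : set nat) (m : nat) : Prop :=
  A m /\ (forall k, A k -> (k <= m)%N).

Definition dimension_is T (n : nat) : Prop :=
  is_max [set #|` s|.-1 | s in simplex T] n.

Definition max_degree_is T (d : nat) : Prop :=
  is_max (range (degree T)) d.

Definition signed_square (x : R) : R := if 0 <= x then x ^+ 2 else - x ^+ 2.

(* The form of R^{p,q}: positive on the first p coordinates, negative on the
   last q ones. *)
Definition minkowski_form (p q : nat) (v w : 'rV[R]_(p + q)) : R :=
  \sum_(i < p) v ord0 (lshift q i) * w ord0 (lshift q i)
  - \sum_(j < q) v ord0 (rshift p j) * w ord0 (rshift p j).

Definition simplicial_map T (N : nat) (h : X -> 'rV[R]_N) : Prop :=
  forall s, simplex T s -> forall x, geom_simplex R s x ->
    h (chart T x) = \sum_(v <- s) x v *: h (vertex_point T v).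

Definition topological_embedding (Y : topologicalType) (h : X -> Y) : Prop :=
  [/\ injective h, continuous h &
      forall U : set X, open U ->
        exists2 W : set Y, open W & h @` U = range h `&` W].

(* The indefinite metric g is a function on the subtype of edges. *)
Definition simplicial_isometric_embedding T (g : edges T -> R) (p q : nat)
    (h : X -> 'rV[R]_(p + q)) : Prop :=
  [/\ simplicial_map T h,
      topological_embedding h &
      forall (e : edges T) (v w : V), val e = [fset v; w]%fset ->
        minkowski_form (h (vertex_point T v) - h (vertex_point T w))
                  (h (vertex_point T v) - h (vertex_point T w))
        = signed_square (g e)].

End Polyhedra.

Arguments simplicial_isometric_embedding {R X V T} g p q h.

(* Main.v *)
From HB Require Import structures.
Require Import Defs.
From mathcomp Require Import all_boot all_order all_algebra finmap.
From mathcomp Require Import all_classical all_reals all_analysis.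
From mathcomp Require Import ring.

Set Implicit Arguments.
Unset Strict Implicit.
Unset Printing Implicit Defensive.

Import Order.TTheory GRing.Theory Num.Theory.
Import numFieldNormedType.Exports.

Local Open Scope classical_set_scope.
Local Open Scope ring_scope.

(** The form of R^{q,q} is the difference of two squared norms, so in the null
    coordinates [u = a - b] and [w = a + b] of a vector [(a, b)] it is the dot
    product of [u] and [w].  This separates the two tasks: [u] alone makes the
    map injective, and for a fixed [u] the edge conditions are linear in [w].

    The vertices are sent by [u] to distinct points of the moment curve, namely
    [u_v = (t_v, t_v ^+ 2, ..., t_v ^+ q)], any [q + 1] of which are affinely
    independent ([moments_eq0]).  Two simplices have together at most
    [2 * n + 2 <= q + 1] vertices, hence the simplicial map defined by [u] is
    injective ([simplicial_moment_curve_injective]).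

    It remains to find [w] with [(u_v - u_v') . (w_v - w_v') = G v v'] on every
    edge.  Reading [w_v] as the list of coefficients of a polynomial [P_v] of
    degree at most [q], of which the constant term is irrelevant, the equation
    says that [P_v - P_v'] has values at [t_v] and [t_v'] that differ by
    [G v v'].  The polynomials are built one vertex after the other by
    interpolation at [t_v] and at the nodes of the neighbours of [v], which are
    at most [d + 1 <= q + 1] nodes ([greedy_interpolation]).

    The topological part uses compactness twice: there are finitely many vertices
    because they form a closed discrete set ([vertices_finite]), and an injective
    continuous map into a Hausdorff space is an embedding
    ([topological_embedding_compact]).  Continuity of the simplicial map comes
    from the coherent topology ([simplicial_extension]). *)

(** * Interpolation on the moment curve *)

(** Newton interpolation: the correction added for a new node vanishes at the
    previous ones. *)
Lemma interpolation (F : fieldType) (I : eqType) (t : I -> F) (s : seq I)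
    (c : I -> F) :
  injective t -> uniq s ->
  exists2 P : {poly F}, (size P <= size s)%N & {in s, forall i, P.[t i] = c i}.
Proof.
move=> t_inj; elim: s => [_|i s IHs /= /andP[iNs us]].
  by exists 0; rewrite ?size_poly0.
have [P sP Pc] := IHs us.
pose Q := \prod_(j <- s) ('X - (t j)%:P).
have Qi : Q.[t i] != 0.
  apply/negP; rewrite -/(root Q (t i)) /Q -(big_map t predT (fun a => 'X - a%:P)).
  by rewrite root_prod_XsubC (mem_map t_inj) (negPf iNs).
exists (P + ((c i - P.[t i]) / Q.[t i]) *: Q).
  rewrite (leq_trans (size_polyD _ _))// geq_max (leq_trans sP)//=.
  by rewrite (leq_trans (size_scale_leq _ _))// size_prod_XsubC.
move=> j; rewrite inE hornerD hornerZ => /predU1P[->|js].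
  by rewrite divfK// addrC subrK.
suff -> : Q.[t j] = 0 by rewrite mulr0 addr0 Pc.
apply/rootP; rewrite /Q -(big_map t predT (fun a => 'X - a%:P)).
by rewrite root_prod_XsubC map_f.
Qed.

(** The Vandermonde argument: an affine dependence between at most [q + 1]
    points of the moment curve, once tested against the polynomial that is 1 at
    one node and 0 at the others, loses all its terms but one. *)
Lemma moments_eq0 (F : fieldType) (I : eqType) (t : I -> F) (q : nat)
    (s : seq I) (c : I -> F) :
    injective t -> uniq s -> (size s <= q.+1)%N ->
    (forall k, (k <= q)%N -> \sum_(i <- s) c i * t i ^+ k = 0) ->
  {in s, forall i, c i = 0}.
Proof.
move=> t_inj us ssq mom i si.
have [P sP Pd] := interpolation (fun j => (j == i)%:R) t_inj us.
have : \sum_(j <- s) c j * P.[t j] = 0.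
  under eq_bigr do rewrite (horner_coef_wide _ (leq_trans sP ssq)) mulr_sumr.
  rewrite exchange_big /= big1// => k _.
  under eq_bigr do rewrite mulrCA.
  by rewrite -mulr_sumr mom ?mulr0// -ltnS.
rewrite (bigD1_seq i)//= Pd// eqxx mulr1 big1_seq ?addr0// => j /andP[ji sj].
by rewrite Pd// (negPf ji) mulr0.
Qed.

Lemma sum_power_differences (F : fieldType) (q : nat) (P : {poly F}) (x y : F) :
  (size P <= q.+1)%N ->
  \sum_(k < q) (x ^+ k.+1 - y ^+ k.+1) * P`_k.+1 = P.[x] - P.[y].
Proof.
move=> sP; rewrite !(horner_coef_wide _ sP) -sumrB big_ord_recl/= subrr add0r.
by apply: eq_bigr => k _; rewrite -mulrBr mulrC.
Qed.

(** The vertices are treated one at a time.  When [i] comes, its constraints with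
    the earlier vertices become prescribed values of [P i] at [t i] and at the
    nodes of its neighbours; these are at most [q + 1] distinct nodes, so degree
    [q] suffices. Asking for the value 0 at [t i] is a normalization, as only
    differences of values of [P i] occur. *)
Lemma greedy_interpolation (F : fieldType) (I : eqType) (t : I -> F) (q : nat)
    (nb : I -> seq I) (G : I -> I -> F) (s : seq I) :
    injective t -> (forall i, uniq (i :: nb i)) ->
    (forall i, size (nb i) <= q)%N ->
    (forall i j, (i \in nb j) = (j \in nb i)) ->
    (forall i j, G i j = G j i) ->
  exists2 P : I -> {poly F}, forall i, (size (P i) <= q.+1)%N &
    {in s &, forall i j, j \in nb i ->
      (P i - P j).[t i] - (P i - P j).[t j] = G i j}.
Proof.
move=> t_inj nb_uniq nb_size nb_sym G_sym.
elim: s => [|i s [P sP PG]]; first by exists (fun=> 0) => //; rewrite size_poly0.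
pose c j := if j == i then 0 else (P j).[t j] - (P j).[t i] - G i j.
have [L sL Lc] := interpolation c t_inj (nb_uniq i).
have [Li Lj] : L.[t i] = 0 /\
    {in nb i, forall j, L.[t j] = (P j).[t j] - (P j).[t i] - G i j}.
  split=> [|j ji]; first by rewrite Lc ?mem_head// /c eqxx.
  rewrite Lc ?inE ?ji ?orbT// /c ifN//; apply: contraL ji => /eqP->.
  by have /andP[] := nb_uniq i.
exists (fun j => if j == i then L else P j) => [j|j k].
  by case: ifP => // _; rewrite (leq_trans sL)// ltnS nb_size.
have nbN : i \notin nb i by have /andP[] := nb_uniq i.
rewrite !inE; have [->|ji] := eqVneq j i; have [->|ki] := eqVneq k i => //=.
- by rewrite (negPf nbN).
- by move=> _ _ ki'; rewrite !hornerE Li Lj//; ring.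
- by move=> _ _; rewrite nb_sym => ji'; rewrite !hornerE Li Lj// (G_sym j i); ring.
- exact: PG.
Qed.

(** * Null coordinates of the split form *)

Section NullCoordinates.
Context (R : realType) (q : nat).
Implicit Types u w : 'rV[R]_q.

(** The vector [(a, b)] of R^{q,q} with [a - b = u] and [a + b = w]; in these
    coordinates |a|^2 - |b|^2 is the dot product of [u] and [w]. *)
Definition of_null_coords u w : 'rV[R]_(q + q) :=
  row_mx (2^-1 *: (w + u)) (2^-1 *: (w - u)).

Lemma of_null_coordsB u w u' w' :
  of_null_coords u w - of_null_coords u' w' = of_null_coords (u - u') (w - w').
Proof.
by rewrite /of_null_coords opp_row_mx add_row_mx -!scalerBr; congr row_mx;
  congr (_ *: _); apply/rowP=> i; rewrite !mxE; ring.
Qed.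

Lemma of_null_coordsK u w (i : 'I_q) :
  of_null_coords u w ord0 (lshift q i) - of_null_coords u w ord0 (rshift q i)
  = u ord0 i.
Proof.
by rewrite row_mxEl row_mxEr !mxE; field.
Qed.

Lemma minkowski_null_coords u w :
  minkowski_form (of_null_coords u w) (of_null_coords u w)
  = \sum_(i < q) u ord0 i * w ord0 i.
Proof.
rewrite /minkowski_form -sumrB; apply: eq_bigr => i _.
by rewrite row_mxEl row_mxEr !mxE; field.
Qed.

End NullCoordinates.

(** * Topology of triangulated spaces *)

Lemma topological_embedding_compact (X Y : topologicalType) (h : X -> Y) :
  compact [set: X] -> hausdorff_space Y -> injective h -> continuous h ->
  topological_embedding h.
Proof.
move=> Xc HY h_inj h_cont; split=> // U oU.
have hCc : compact (h @` ~` U).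
  apply: continuous_compact; first exact: continuous_subspaceT.
  exact: subclosed_compact (open_closedC oU) Xc _.
exists (~` (h @` ~` U)); first exact: closed_openC (compact_closed HY hCc).
apply/seteqP; split=> [_ [x Ux <-]|_ [[x _ <-] nU]].
  by split; [exists x | case=> y nUy /h_inj yx; apply: nUy; rewrite yx].
by exists x => //; apply: contrapT => nUx; apply: nU; exists x.
Qed.

Section Barycentric.
Context (R : realType) (V : choiceType).
Implicit Types (s t : {fset V}) (x : {ptws V -> R}).

Lemma bary_continuous (v : V) : continuous (fun x : {ptws V -> R} => x v).
Proof. exact: (@proj_continuous V (fun=> R) v). Qed.

Lemma weighted_sum_continuous (W : normedModType R) (r : seq V) (H : V -> W) :
  continuous (fun x : {ptws V -> R} => \sum_(v <- r) x v *: H v).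
Proof.
elim: r => [|v r IHr].
  have -> : (fun x : {ptws V -> R} => \sum_(v <- [::]) x v *: H v) = cst 0.
    by apply/funext => x; rewrite big_nil.
  exact: cst_continuous.
have -> : (fun x : {ptws V -> R} => \sum_(w <- v :: r) x w *: H w) =
    (fun x => x v *: H v) + (fun x => \sum_(w <- r) x w *: H w).
  by apply/funext => x; rewrite big_cons.
move=> x; apply: continuousD (IHr x).
apply: (@continuous_comp _ _ _ (fun x : {ptws V -> R} => x v)
  (fun k : R => k *: H v)); first exact: bary_continuous.
exact: scalel_continuous.
Qed.

Lemma geom_simplex_closed s : closed (geom_simplex R s).
Proof.
have -> : geom_simplex R s =
    (\bigcap_v [set x | 0 <= x v]) `&`
    (\bigcap_(v in [set v | v \notin s]) [set x | x v = 0]) `&`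
    [set x | \sum_(v <- s) x v *: (1 : R^o) = 1].
  apply/seteqP; split=> [x [x0 xs x1]|x [[x0 xs] x1]].
    split; first by split=> v; [move=> _; exact: x0 | exact: xs].
    rewrite /= -[RHS]x1; apply: eq_bigr => v _; exact: mulr1.
  split=> [v|v|]; [exact: x0 | exact: xs |].
  rewrite -[RHS]x1; apply: eq_bigr => v _; exact/esym/mulr1.
have bary_closed v := iffLR (continuous_closedP _) (@bary_continuous v).
apply: closedI; first apply: closedI.
- by apply: closed_bigI => v _; exact: (bary_closed v [set r | 0 <= r] (@closed_ge R 0)).
- by apply: closed_bigI => v _; exact: (bary_closed v [set r | r = 0] (@closed_eq R 0)).
- have /continuous_closedP := @weighted_sum_continuous R^o s (fun=> 1).
  by move=> /(_ [set r | r = 1]); apply; exact: closed_eq.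
Qed.

Lemma bary_vertex_simplex (v : V) : geom_simplex R [fset v]%fset (bary_vertex R v).
Proof.
split=> [w|w|]; rewrite /bary_vertex ?ler0n//.
  by rewrite inE => /negPf->.
by rewrite big_seq_fset1 eqxx.
Qed.

Lemma bary_vertex_mem s (v : V) : geom_simplex R s (bary_vertex R v) -> v \in s.
Proof.
case=> _ b0 _; apply: contraT => /b0; rewrite /bary_vertex eqxx => /eqP.
by rewrite oner_eq0.
Qed.

Lemma bary_vertex_inj : injective (bary_vertex R (V := V)).
Proof.
move=> v w vw; have := bary_vertex_simplex v; rewrite vw.
by move=> /bary_vertex_mem; rewrite inE => /eqP.
Qed.

Lemma geom_simplex_sum (W : lmodType R) s (r : {fset V}) x (H : V -> W) :
  geom_simplex R s x -> (s `<=` r)%fset ->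
  \sum_(v <- r) x v *: H v = \sum_(v <- s) x v *: H v.
Proof.
case=> _ x0 _ sr; rewrite -(big_fset_incl _ sr)// => v _ /x0->.
by rewrite scale0r.
Qed.

End Barycentric.

Section Triangulated.
Context (R : realType) (X : topologicalType) (V : choiceType).
Context (T : triangulation R X V).

Lemma chart_inj s t x y :
  simplex T s -> geom_simplex R s x -> simplex T t -> geom_simplex R t y ->
  chart T x = chart T y -> x = y.
Proof.
move=> Ts sx Tt ty; have [_ inj _] := chart_bij T.
by apply: inj; rewrite inE; [exists s | exists t].
Qed.

(** The coherent topology makes continuity a condition on each closed simplex,
    where [h] may be replaced by any map continuous on the whole of R^V. *)
Lemma continuous_on_simplices (Y : topologicalType) (h : X -> Y)
    (F : {fset V} -> {ptws V -> R} -> Y) :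
    (forall s, simplex T s -> continuous (F s)) ->
    (forall s x, simplex T s -> geom_simplex R s x -> h (chart T x) = F s x) ->
  continuous h.
Proof.
move=> Fc hF; apply/continuous_closedP => C cC; apply/(chart_closedP T) => s Ts.
have -> : geom_simplex R s `&` chart T @^-1` (h @^-1` C) =
    geom_simplex R s `&` F s @^-1` C.
  by apply/seteqP; split=> x [sx]; rewrite /= (hF s)//.
apply: closedI; first exact: geom_simplex_closed.
by move/continuous_closedP : (Fc s Ts); apply.
Qed.

Lemma vertex_point_inj : injective (vertex_point T).
Proof.
move=> v w vw; apply: (@bary_vertex_inj R V).
exact: (chart_inj (simplex_vertex T v) (@bary_vertex_simplex R V v)
  (simplex_vertex T w) (@bary_vertex_simplex R V w) vw).
Qed.

(** A closed simplex contains finitely many vertices, so every set of vertices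
    has a closed trace on it. In other words, the vertices form a closed discrete
    subset of [X]. *)
Lemma vertex_points_closed (A : set V) : closed (vertex_point T @` A).
Proof.
apply/(chart_closedP T) => s Ts.
have /accessible_finite_set_closed : accessible_space {ptws V -> R}.
  apply: hausdorff_accessible.
  by apply: (@hausdorff_product V (fun=> R)) => _; exact: norm_hausdorff.
apply.
apply: (@sub_finite_set _ _ (bary_vertex R @` [set` s])); last first.
  exact/finite_image/finite_fset.
move=> x [sx [v _ vx]]; exists v.
  suff xv : bary_vertex R v = x by rewrite -xv in sx; exact: bary_vertex_mem sx.
  exact: (chart_inj (simplex_vertex T v) (@bary_vertex_simplex R V v) Ts sx vx).
exact: (chart_inj (simplex_vertex T v) (@bary_vertex_simplex R V v) Ts sx vx).
Qed.

(** For each vertex [v], remove from [X] all the other vertices: this open set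
    contains [v] and no other vertex. These sets cover [X], and a finite subcover
    misses all but finitely many vertices. *)
Lemma vertices_finite : compact [set: X] -> finite_set [set: V].
Proof.
move=> Xc; apply: contrapT => Vinf.
have [v0 _] : [set: V] !=set0.
  by apply/set0P/eqP => V0; apply: Vinf; rewrite V0.
(* [compact_cover] needs a base point; any vertex will do. *)
pose pX := HB.pack_for ptopologicalType X (isPointed.Build X (vertex_point T v0)).
move: (Xc : compact [set: pX]); rewrite compact_cover.
pose U (v : V) : set pX := ~` (vertex_point T @` [set w | w <> v]).
case/(_ V setT U) => [v _|x _|D _ cov].
- exact/closed_openC/vertex_points_closed.
- have [[v _ <-]|nvx] := pselect (range (vertex_point T) x).
    by exists v => // -[w wv /vertex_point_inj].
  by exists v0 => // -[w _ wx]; apply: nvx; exists w.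
- apply: Vinf; apply: sub_finite_set (finite_fset D) => v _.
  have [w wD Uwv] := cov (vertex_point T v) I.
  suff -> : v = w by [].
  by apply: contrapT => vw; apply: Uwv; exists v.
Qed.

(** A point lying in several simplices has the same barycentric coordinates in
    all of them, so the affine formulas agree. *)
Lemma simplicial_extension (N : nat) (H : V -> 'rV[R]_N) :
  exists h : X -> 'rV[R]_N, [/\ simplicial_map T h, continuous h &
    forall v, h (vertex_point T v) = H v].
Proof.
have /boolp.choice[h hE] : forall x, exists z, forall s y, simplex T s ->
    geom_simplex R s y -> chart T y = x -> z = \sum_(v <- s) y v *: H v.
  move=> x; have [_ _ /(_ x I)[y [s Ts sy] yx]] := chart_bij T.
  exists (\sum_(v <- s) y v *: H v) => t z Tt tz zx.
  have yz : y = z by apply: (chart_inj Ts sy Tt tz); rewrite yx zx.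
  rewrite -yz in tz *.
  by rewrite -(geom_simplex_sum H sy (fsubsetUl s t))
    -(geom_simplex_sum H tz (fsubsetUr s t)).
have hv v : h (vertex_point T v) = H v.
  rewrite (hE _ _ _ (simplex_vertex T v) (@bary_vertex_simplex R V v))//.
  by rewrite big_seq_fset1 /bary_vertex eqxx scale1r.
exists h; split=> //.
  move=> s Ts x sx; rewrite (hE _ s x)//.
  by under [RHS]eq_bigr do rewrite hv.
apply: (@continuous_on_simplices _ h (fun s x => \sum_(v <- s) x v *: H v)).
  by move=> s _; exact: weighted_sum_continuous.
by move=> s x Ts sx; exact: hE.
Qed.

Lemma neighbours_size (vs : {fset V}) (v : V) :
  (size [seq w <- vs | `[< edges T [fset v; w]%fset >]] <= degree T v)%N.
Proof.
have finE : finite_set [set e | edges T e /\ v \in e].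
  by apply: sub_finite_set (locally_finite T v) => e [[]].
rewrite -(size_map (fun w => [fset v; w]%fset)); apply: uniq_leq_size.
  rewrite map_inj_in_uniq ?filter_uniq// => w w'.
  rewrite mem_filter => /andP[/asboolP[_ card_vw] _] _ /fsetP/(_ w).
  rewrite !inE eqxx orbT => /esym/orP[|] /eqP // wv.
  by rewrite wv cardfs2 eqxx in card_vw.
move=> e /mapP[w]; rewrite mem_filter => /andP[/asboolP vw _] ->.
by rewrite in_fset_set// inE/=; split=> //; rewrite !inE eqxx.
Qed.

End Triangulated.

(** * Assembling the embedding *)

Section MomentCurve.
Context (R : realType) (X : topologicalType) (V : choiceType).
Context (T : triangulation R X V) (t : V -> R) (q : nat).

Definition moment_curve (x : R) : 'rV[R]_q := \row_(k < q) x ^+ k.+1.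

(** Two simplices have together at most [2 * n + 2] vertices, so their images
    on the moment curve are affinely independent as soon as [2 * n + 1 <= q]:
    a point of [X] can be recovered from its null coordinates [u] alone, whatever
    the coordinates [w] are. *)
Lemma simplicial_moment_curve_injective (n : nat) (w : V -> 'rV[R]_q)
    (h : X -> 'rV[R]_(q + q)) :
    injective t -> (forall s, simplex T s -> (#|` s| <= n.+1)%N) ->
    (2 * n + 1 <= q)%N ->
    simplicial_map T h ->
    (forall v, h (vertex_point T v) = of_null_coords (moment_curve (t v)) (w v)) ->
  injective h.
Proof.
move=> t_inj dimT nq h_simp hv x x'; have [_ _ surj] := chart_bij T.
have [y [s Ts sy] <-] := surj x I; have [y' [s' Ts' sy'] <-] := surj x' I.
rewrite (h_simp s Ts y sy) (h_simp s' Ts' y' sy').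
set r := (s `|` s')%fset.
rewrite -(geom_simplex_sum _ sy (fsubsetUl s s')).
rewrite -(geom_simplex_sum _ sy' (fsubsetUr s s')) -/r => hyy'.
have sr : (size r <= q.+1)%N.
  rewrite -/(#|` r|) (leq_trans (leq_card_fsetU _ _))//.
  rewrite (leq_trans (leq_add (dimT _ Ts) (dimT _ Ts')))//.
  by rewrite addSn addnS addnn -mul2n -addn1 addSn ltnS.
have coordE (z : {ptws V -> R}) (i : 'I_q) :
    (\sum_(v <- r) z v *: h (vertex_point T v)) ord0 (lshift q i)
    - (\sum_(v <- r) z v *: h (vertex_point T v)) ord0 (rshift q i)
    = \sum_(v <- r) z v * t v ^+ i.+1.
  rewrite !summxE -sumrB; apply: eq_bigr => v _.
  rewrite [X in X - _]mxE [X in _ - X]mxE -mulrBr hv of_null_coordsK.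
  by rewrite mxE.
have yy'0 : {in r, forall v, y v - y' v = 0}.
  apply: (moments_eq0 (c := fun v => y v - y' v) t_inj (fset_uniq r) sr) => k kq.
  under eq_bigr do rewrite mulrBl.
  rewrite sumrB; apply/eqP; rewrite subr_eq0; apply/eqP; case: k kq => [_|k kq].
    under eq_bigr do rewrite expr0 mulr1; under [RHS]eq_bigr do rewrite expr0 mulr1.
    have [_ y0 y1] := sy; have [_ y'0 y'1] := sy'.
    rewrite -(big_fset_incl _ (fsubsetUl s s')) ?y1 => [|v _ /y0//].
    by rewrite -(big_fset_incl _ (fsubsetUr s s')) ?y'1 => [|v _ /y'0//].
  by rewrite -(coordE y (Ordinal kq)) -(coordE y' (Ordinal kq)) hyy'.
congr (chart T _); apply/funext => v.
have [/yy'0/eqP|] := boolP (v \in r); first by rewrite subr_eq0 => /eqP.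
rewrite inE negb_or => /andP[sv s'v].
by have [_ -> // _] := sy; have [_ -> // _] := sy'.
Qed.

End MomentCurve.

Lemma finite_type_injection (R : realType) (V : choiceType) :
  finite_set [set: V] -> exists t : V -> R, injective t.
Proof.
move=> Vfin; have inV v : v \in fset_set [set: V] by rewrite in_fset_set// inE.
exists (fun v => (index v (fset_set [set: V]))%:R) => v w /eqP.
rewrite eqr_nat => /eqP; exact: index_inj (inV v) (inV w).
Qed.

Theorem theorem1 (R : realType) (X : topologicalType) (V : choiceType)
    (T : triangulation R X V) (g : edges T -> R) (n d : nat)
    (X_compact : compact [set: X]%classic)
    (dim_n : dimension_is T n)
    (max_deg : max_degree_is T d) :
  let q := maxn d (2 * n + 1) in
  exists h : X -> 'rV[R]_(q + q), simplicial_isometric_embedding g q q h.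
Proof.
move=> q; have Vfin := vertices_finite T X_compact.
have [t t_inj] := finite_type_injection R Vfin.
pose vs := fset_set [set: V].
have vsP v : v \in vs by rewrite in_fset_set// inE.
pose nb v := [seq w <- vs | `[< edges T [fset v; w]%fset >]].
have nbE v w : (w \in nb v) = `[< edges T [fset v; w]%fset >].
  by rewrite mem_filter vsP andbT.
have nb_uniq v : uniq (v :: nb v).
  rewrite /= filter_uniq ?fset_uniq// andbT nbE; apply/asboolP => -[_].
  by rewrite cardfs2 eqxx.
have nb_size v : (size (nb v) <= q)%N.
  rewrite (leq_trans (neighbours_size T vs v))// leq_max.
  by rewrite (proj2 max_deg)//; exists v.
have nb_sym v w : (v \in nb w) = (w \in nb v) by rewrite !nbE fsetUC.
pose G v w := if insub [fset v; w]%fset is Some e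
  then signed_square (g (e : edges T)) else 0.
have G_sym v w : G v w = G w v by rewrite /G fsetUC.
have [P sP PG] := greedy_interpolation vs t_inj nb_uniq nb_size nb_sym G_sym.
pose u v := moment_curve q (t v).
(* The constant terms are dropped: only differences of values matter. *)
pose w v : 'rV[R]_q := \row_(k < q) (P v)`_k.+1.
have [h [h_simp h_cont hv]] :=
  simplicial_extension T (fun v => of_null_coords (u v) (w v)).
have dimT s : simplex T s -> (#|` s| <= n.+1)%N.
  move=> Ts; have : (#|` s|.-1 <= n)%N by apply: (proj2 dim_n); exists s.
  by case: #|` s|.
exists h; split=> //.
  apply: (topological_embedding_compact X_compact _ _ h_cont).
    exact: (@norm_hausdorff R 'rV[R]_(q + q)).
  by apply: (simplicial_moment_curve_injective t_inj dimT _ h_simp hv);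
    rewrite leq_maxr.
move=> e v v' evv'.
have ee : edges T [fset v; v']%fset by rewrite -evv'; have := valP e; rewrite inE.
rewrite !hv of_null_coordsB minkowski_null_coords.
have -> : signed_square (g e) = G v v' by rewrite /G -evv' valK.
rewrite -PG//; last by rewrite nbE; exact/asboolP.
rewrite -(@sum_power_differences _ q).
  by apply: eq_bigr => k _; rewrite !mxE coefB.
by rewrite (leq_trans (size_polyD _ _))// geq_max size_polyN !sP.
Qed.
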